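(* Let $f(x) = \frac12\langle Ax,x\rangle - \langle b,x\rangle$, $x \in \mathbb{E}$, where $A : \mathbb{E}\to\mathbb{E}^*$ is a self-adjoint positive definite linear operator with $\mu B \preceq A \preceq LB$ for some $\mu, L>0$, and $b \in \mathbb{E}^*$. Let $(x_k)_{k \ge 0}$, $(G_k)_{k\ge 0}$ be generated by the quasi-Newton scheme described in the context (with arbitrary $x_0 \in \mathbb{E}$, $u_k \in \mathbb{E}$, $\tau_k \in [0,1]$). Then, for all $k \geq 0$, we have $$A \preceq G_k \preceq \frac{L}{\mu}A,$$ and $$\lambda_f(x_k) \leq \left(1 - \frac{\mu}{L}\right)^k\lambda_f(x_0).$$
   Context: $\mathbb{E}$ is an $n$-dimensional real vector space, $\mathbb{E}^*$ its dual, and $\langle s, x\rangle$ is the value of $s \in \mathbb{E}^*$ at $x \in \mathbb{E}$. For self-adjoint $A, A_1 : \mathbb{E} \to \mathbb{E}^*$, $A \preceq A_1$ means $\langle (A_1 - A)x, x\rangle \ge 0$ for all $x \in \mathbb{E}$. For $u \in \mathbb{E}$, $u^*$ denotes the map $s \mapsto \langle s, u\rangle$ on $\mathbb{E}^*$; thus $uu^* : \mathbb{E}^*\to\mathbb{E}$ is $s \mapsto \langle s,u\rangle u$, and e.g. $Auu^*G$ is the operator $\mathbb{E}\to\mathbb{E}^*$, $x \mapsto \langle Gx, u\rangle Au$. A basis $e_1,\dots,e_n$ of $\mathbb{E}$ is fixed, and $B = \left(\sum_{i=1}^n e_ie_i^*\right)^{-1} : \mathbb{E}\to\mathbb{E}^*$.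 For self-adjoint positive definite $A$, self-adjoint $G$ with $A \preceq G$, $u \in \mathbb{E}$ and $\tau \in \mathbb{R}$: if $Gu \ne Au$, define $$\mathrm{Broyd}_\tau(G,A,u) = \tau\left[G - \frac{Auu^*G + Guu^*A}{\langle Au,u\rangle} + \left(\frac{\langle Gu,u\rangle}{\langle Au,u\rangle}+1\right)\frac{Auu^*A}{\langle Au,u\rangle}\right] + (1-\tau)\left[G - \frac{(G-A)uu^*(G-A)}{\langle (G-A)u,u\rangle}\right],$$ and if $Gu = Au$, define $\mathrm{Broyd}_\tau(G,A,u) = G$. Quasi-Newton scheme: choose $x_0 \in \mathbb{E}$ and set $G_0 = LB$. For $k \ge 0$: (1) $x_{k+1} = x_k - G_k^{-1}\nabla f(x_k)$; (2) choose $u_k \in \mathbb{E}$ and $\tau_k \in [0,1]$; (3) $G_{k+1} = \mathrm{Broyd}_{\tau_k}(G_k, A, u_k)$. $\lambda_f(x) = \langle \nabla f(x), A^{-1}\nabla f(x)\rangle^{1/2}$. *)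

(* Defs.v *)
From mathcomp Require Import all_boot all_order all_algebra.
From mathcomp Require Import all_classical all_reals all_analysis.

Set Implicit Arguments.
Unset Strict Implicit.
Unset Printing Implicit Defensive.

Import Order.TTheory GRing.Theory Num.Theory.
Import numFieldNormedType.Exports.

Local Open Scope ring_scope.

(* The dual space E^*; the value <s, x> is the application s x. *)
Notation dual R E := 'Hom(E, R^o).

Section Operators.
Context {R : realType} {E : vectType R}.
Implicit Types (A G : 'Hom(E, dual R E)) (u x : E).

Definition self_adjoint A := forall x y, A x y = A y x.

Definition positive_definite A := forall x, x != 0 -> 0 < A x x.

Definition lop_le A A1 := forall x, 0 <= (A1 - A) x x.

(* The operator u u^* : s |-> <s, u> u. *)
Definition rank1 u : 'Hom(dual R E, E) :=
  linfun (fun s : dual R E => (s u : R) *: u).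

(* Only meaningful for A self-adjoint positive definite, G self-adjoint and
   lop_le A G: then both denominators are positive as soon as G u != A u. *)
Definition Broyd (tau : R) G A u : 'Hom(E, dual R E) :=
  if G u == A u then G else
  tau *: (G
          - (A u u)^-1 *: ((A \o rank1 u \o G)%VF + (G \o rank1 u \o A)%VF)
          + ((G u u / A u u + 1) / A u u) *: (A \o rank1 u \o A)%VF)
  + (1 - tau) *:
      (G - ((G - A) u u)^-1 *: ((G - A) \o rank1 u \o (G - A))%VF).

Definition quad A (b : dual R E) (x : E) : R := 2^-1 * A x x - b x.

End Operators.

Notation "A '⪯' G" := (lop_le A G) (at level 70, no associativity).

Section Basis.
Context {R : realType} {E : vectType R} {n : nat}.
Variable e : n.-tuple E.

(* ^-1%VF is the two-sided inverse here, the sum being bijective when e is a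
   basis of E; likewise below for the positive definite A and G k. *)
Definition Bop : 'Hom(E, dual R E) := (\sum_(i < n) rank1 e`_i)^-1%VF.

Definition coords (x : E) : 'rV[R]_n := \row_i coord e i x.

Definition of_coords (v : 'rV[R]_n) : E := \sum_(i < n) v 0 i *: e`_i.

(* vectType carries no norm, so the Fréchet differential is taken in the
   coordinates of the basis e; its value does not depend on the basis. *)
Definition grad (f : E -> R) (x : E) : dual R E :=
  linfun (fun h : E =>
    'd (fun v : 'rV[R]_n => f (of_coords v) : R^o) (coords x) (coords h)
      : R^o).

Definition quasi_newton (f : E -> R) (A : 'Hom(E, dual R E)) (L : R)
    (x : nat -> E) (G : nat -> 'Hom(E, dual R E))
    (u : nat -> E) (tau : nat -> R) : Prop :=
  [/\ G 0%N = L *: Bop,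
      forall k, x k.+1 = x k - (G k)^-1%VF (grad f (x k)),
      forall k, 0 <= tau k <= 1
    & forall k, G k.+1 = Broyd (tau k) (G k) A (u k)].

Definition lambda (f : E -> R) (A : 'Hom(E, dual R E)) (x : E) : R :=
  Num.sqrt (grad f x (A^-1%VF (grad f x))).

End Basis.

(* Main.v *)
From HB Require Import structures.
Require Import Defs.
From mathcomp Require Import all_boot all_order all_algebra.
From mathcomp Require Import all_classical all_reals all_analysis.
From mathcomp Require Import ring lra.

Import Order.TTheory GRing.Theory Num.Theory.
Import numFieldNormedType.Exports.
Local Open Scope ring_scope.

(** The operators are treated as bilinear forms [A x y].

    Sandwich.  With [y = x - (<Ax,u> / <Au,u>) u], completing the square gives
    [<DFP(G) x, x> = <G y, y> + <Ax,u>^2 / <Au,u>], and the same identity with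
    [G] replaced by [A] reads
    [<A x, x> = <A y, y> + <Ax,u>^2 / <Au,u>].  Comparing the two
    shows that the DFP update keeps [A ⪯ G ⪯ eta A] as soon as [1 <= eta]
    ([DFP_bounds]).  The SR1 update replaces [D = G - A] by
    [D - D u u^* D / <D u, u>], which lies between [0] and [D] by the
    Cauchy-Schwarz inequality for [D] ([SR1_bounds]).  The Broyden update is a
    convex combination of the two, so the sandwich with [eta = L / mu], true
    for [G_0 = L B], propagates by induction ([Broyd_bounds]).

    Rate.  Since [grad f x = A x - b] ([grad_quad]), the error
    [r_k = x_k - A^-1 b] satisfies [r_{k+1} = (I - G_k^-1 A) r_k] and
    [lambda (x_k)] is the [A]-norm of [r_k].  By duality the sandwich inverts to
    [A / eta <= A G^-1 A <= A], so the operator [D = A - A G^-1 A] satisfies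
    [0 ⪯ D ⪯ c A] with [c = 1 - 1 / eta] ([residual_bounds]).  For
    [w = r_{k+1}] one has [A w = D r_k], hence Cauchy-Schwarz for [D] gives
    [<Aw,w>^2 = <D r_k, w>^2 <= c^2 <A r_k, r_k> <A w, w>], which is the
    contraction by the factor [c] without any spectral decomposition
    ([newton_contraction]). *)

(** * Operators as bilinear forms *)

Section Forms.
Set Implicit Arguments.
Context {R : realType} {E : vectType R}.
Implicit Types (A G D : 'Hom(E, dual R E)) (u x y z : E) (eta tau : R).

(** The right-hand sides below are typed in [R] rather than in [R^o], so that
    real arithmetic applies to them after rewriting. *)
Lemma lopDl A x y z : A (x + y) z = A x z + A y z :> R.
Proof. by rewrite linearD add_lfunE. Qed.

Lemma lopNl A x z : A (- x) z = - A x z :> R.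
Proof. by rewrite linearN opp_lfunE. Qed.

Lemma lopZl A (a : R) x z : A (a *: x) z = a * A x z :> R.
Proof. by rewrite linearZ scale_lfunE. Qed.

Lemma lopDr A x y z : A z (x + y) = A z x + A z y :> R.
Proof. by rewrite linearD. Qed.

Lemma lopNr A x z : A z (- x) = - A z x :> R.
Proof. by rewrite linearN. Qed.

Lemma lopZr A (a : R) x z : A z (a *: x) = a * A z x :> R.
Proof. by rewrite linearZ. Qed.

Definition lop_bilinE := (lopDl, lopDr, lopNl, lopNr, lopZl, lopZr).

Lemma sub_lopE A G x y : (G - A) x y = G x y - A x y :> R.
Proof. by rewrite !(add_lfunE, opp_lfunE). Qed.

Lemma add_lopE A G x y : (G + A) x y = G x y + A x y :> R.
Proof. by rewrite !add_lfunE. Qed.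

Lemma scale_lopE A (a : R) x y : (a *: A) x y = a * A x y :> R.
Proof. by rewrite !scale_lfunE. Qed.

Lemma rank1E u (s : dual R E) : rank1 u s = (s u : R) *: u.
Proof.
pose f (s : dual R E) : E := (s u : R) *: u.
have flin : linear f.
  by move=> a s1 s2; rewrite /f add_lfunE scale_lfunE scalerDl scalerA.
pose F : {linear dual R E -> E} :=
  HB.pack f (GRing.isLinear.Build _ _ _ _ f flin).
exact: (lfunE F).
Qed.

Lemma lop_leP A G : (forall x, (A x x : R) <= G x x) <-> A ⪯ G.
Proof. by split=> AG x; have := AG x; rewrite sub_lopE subr_ge0. Qed.

Definition psd D := forall x, 0 <= D x x.

(** The form may be degenerate: if [D y y = 0], then [D (x - t y) (x - t y)] is
    affine in [t], and its nonnegativity forces [D x y = 0]; otherwise expand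
    the form at [D y y x - D x y y]. *)
Lemma cauchy_schwarz D x y : self_adjoint D -> psd D ->
  (D x y : R) ^+ 2 <= D x x * D y y.
Proof.
move=> Dsa D0.
have [Dyy|Dyy] := eqVneq (D y y : R) 0.
  suff -> : D x y = 0 :> R by rewrite Dyy mulr0 expr0n.
  apply/eqP; apply: contraT => Dxy.
  (* With this multiple of y the value of the form is -1. *)
  have := D0 (x - ((D x x + 1) / (2 * D x y) : R) *: y).
  rewrite !lop_bilinE (Dsa y x) Dyy.
  move: (D x x : R) (D x y : R) Dxy => a b b0 H.
  suff: 0 <= (-1 : R) by rewrite ler0N1.
  by apply: le_trans H _; rewrite le_eqVlt; apply/orP; left; apply/eqP; field.
have := D0 ((D y y : R) *: x - (D x y : R) *: y).
rewrite !lop_bilinE (Dsa y x).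
have Dyy0 : (0 : R) < D y y by rewrite lt0r Dyy D0.
move: (D x x : R) (D x y : R) (D y y : R) Dyy0 => a b c c0 H.
rewrite -subr_ge0 -(pmulr_rge0 _ c0); move: H.
by lra.
Qed.

End Forms.

(** * The gradient of a quadratic function *)

Section Gradient.
Set Implicit Arguments.
Context {R : realType}.

Lemma row_coord_norm_le (n : nat) (v : 'rV[R]_n) i : `|v 0 i| <= `|v|.
Proof.
rewrite [X in _ <= X]/Num.norm/= mx_normrE.
exact: (le_bigmax _ (fun ij : 'I_1 * 'I_n => `|v ij.1 ij.2|) (0, i)).
Qed.

Lemma row_functional_bound (n : nat) (l : {linear 'rV[R]_n -> R^o})
    (v : 'rV[R]_n) :
  `|l v| <= (\sum_i `|l (delta_mx 0 i)|) * `|v|.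
Proof.
rewrite {1}(row_sum_delta v) linear_sum /=.
apply: le_trans (ler_norm_sum _ _ _) _.
rewrite mulr_suml; apply: ler_sum => i _.
rewrite linearZ normrM mulrC; apply: ler_wpM2l => //.
exact: row_coord_norm_le.
Qed.

Lemma row_functional_continuous (n : nat) (l : {linear 'rV[R]_n -> R^o}) :
  continuous l.
Proof.
apply/linear_bounded_continuous/linear_boundedP.
near=> r => v; apply: le_trans (row_functional_bound l v) _.
by apply: ler_wpM2r => //; near: r; exact: nbhs_pinfty_ge.
Unshelve. all: by end_near. Qed.

Context {E : vectType R} {n : nat}.
Implicit Types (e : n.-tuple E) (A : 'Hom(E, dual R E)) (b s : dual R E).

(** The functional [s] read in the coordinates of [e]; named so that it can
    carry a linear structure. *)
Definition row_functional e s (v : 'rV[R]_n) : R^o := s (of_coords e v).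

Lemma row_functional_linear e s : linear (row_functional e s).
Proof.
move=> a v w; rewrite /row_functional -linearP; congr (s _).
rewrite /of_coords scaler_sumr -big_split; apply: eq_bigr => i _.
by rewrite !mxE scalerDl scalerA.
Qed.

HB.instance Definition _ e s :=
  GRing.isLinear.Build _ _ _ _ (row_functional e s) (row_functional_linear e s).

Lemma of_coordsD e v w : of_coords e (v + w) = of_coords e v + of_coords e w.
Proof.
rewrite /of_coords -big_split; apply: eq_bigr => i _.
by rewrite !mxE scalerDl.
Qed.

Lemma coordsK e x : basis_of fullv e -> of_coords e (coords e x) = x.
Proof.
move=> he; rewrite [RHS](coord_basis he (memvf x)).
by apply: eq_bigr => i _; rewrite mxE.
Qed.

(** The quadratic term is [\sum_i v_i * A e_i (of_coords e v)], a sum of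
    products of two linear functionals, each bounded by a multiple of [`|v|]. *)
Lemma quadratic_remainder_bound e A : exists C : R, forall v : 'rV[R]_n,
  `|A (of_coords e v) (of_coords e v) : R| <= C * `|v| ^+ 2.
Proof.
pose K s := \sum_i `|row_functional e s (delta_mx 0 i)|.
exists (\sum_(i < n) K (A e`_i)) => v.
rewrite {1}/of_coords [A _]linear_sum sum_lfunE.
apply: le_trans (ler_norm_sum _ _ _) _.
rewrite mulr_suml; apply: ler_sum => i _.
rewrite linearZ scale_lfunE normrM expr2 mulrA mulrC.
have coord_le := row_coord_norm_le v i.
apply: ler_pM => //.
exact: (row_functional_bound (row_functional e (A e`_i))).
Qed.

(** The increment of [quad A b] at [x] in the direction [h] is exactly
    [(A x - b) h + A h h / 2], by symmetry of [A], and the last term is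
    [o(h)]. *)
Lemma grad_quad e A b x : basis_of fullv e -> self_adjoint A ->
  grad e (quad A b) x = A x - b.
Proof.
move=> he Asa; rewrite /grad.
set f := fun v : 'rV[R]_n => _ : R^o.
have df : 'd f (coords e x) = row_functional e (A x - b) :> (_ -> R^o).
  apply: diff_unique; first exact: row_functional_continuous.
  apply/eqaddoP => eps eps0 /=.
  have [C HC] := quadratic_remainder_bound e A.
  have remE v : (f \o shift (coords e x)) v - (f (coords e x) +
      row_functional e (A x - b) v) =
      2^-1 * (A (of_coords e v) (of_coords e v) : R).
    rewrite /f /row_functional /quad /= of_coordsD !coordsK //.
    set h := of_coords e v.
    rewrite !(linearD, add_lfunE, opp_lfunE) /=.
    rewrite !add_lfunE (Asa h x).
    by field.
  near=> v; rewrite !fctE (remE v) normrM.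
  have C1 : 0 < `|C| + 1 by rewrite ltr_wpDl.
  have vsmall : `|v| <= eps / (`|C| + 1).
    near: v.
    by apply: (@nbhs0_le R 'rV[R]_n (eps / (`|C| + 1))); rewrite divr_gt0.
  apply: (@le_trans _ _ (`|C| * `|v| ^+ 2)).
    rewrite -[X in _ <= X]mul1r ler_pM //.
      by rewrite ger0_norm; lra.
    by apply: le_trans (HC v) _; rewrite ler_wpM2r ?exprn_ge0// ler_norm.
  rewrite expr2 mulrA ler_wpM2r //.
  apply: (@le_trans _ _ ((`|C| + 1) * (eps / (`|C| + 1)))).
    by rewrite ler_pM// lerDl.
  by rewrite mulrC divfK // gt_eqF.
rewrite df (_ : (fun h => _) = (A x - b : E -> R^o)); last first.
  by apply/funext => h; rewrite /row_functional coordsK.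
by apply/lfunP => h; rewrite lfunE.
Unshelve. all: by end_near.
Qed.

End Gradient.

(** * Broyden updates preserve the sandwich *)

Section Updates.
Set Implicit Arguments.
Context {R : realType} {E : vectType R}.
Implicit Types (A G D : 'Hom(E, dual R E)) (u x y z : E) (eta tau : R).

Definition DFP G A u : 'Hom(E, dual R E) :=
  G - (A u u)^-1 *: ((A \o rank1 u \o G)%VF + (G \o rank1 u \o A)%VF)
    + ((G u u / A u u + 1) / A u u) *: (A \o rank1 u \o A)%VF.

Definition SR1 G A u : 'Hom(E, dual R E) :=
  G - ((G - A) u u)^-1 *: ((G - A) \o rank1 u \o (G - A))%VF.

Lemma sandwichE A G u x y : (A \o rank1 u \o G)%VF x y = G x u * A u y :> R.
Proof. by rewrite !comp_lfunE rank1E lopZl. Qed.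

Lemma DFPE A G u x y : DFP G A u x y =
  G x y - (A u u)^-1 * (G x u * A u y + A x u * G u y)
  + (G u u / A u u + 1) / A u u * (A x u * A u y) :> R.
Proof.
by rewrite /DFP add_lopE sub_lopE !scale_lopE add_lopE !sandwichE.
Qed.

Lemma SR1E A G u x y : SR1 G A u x y =
  G x y - ((G - A) u u)^-1 * ((G - A) x u * (G - A) u y) :> R.
Proof. by rewrite [LHS]sub_lopE scale_lopE sandwichE. Qed.

Lemma BroydE tau G A u : G u != A u ->
  Broyd tau G A u = tau *: DFP G A u + (1 - tau) *: SR1 G A u.
Proof. by rewrite /Broyd => /negbTE ->. Qed.

(* Otherwise rewriting with DFPE or SR1E unfolds them against every difference
   of operators. *)
Local Opaque DFP SR1.

Lemma self_adjointB A G :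
  self_adjoint A -> self_adjoint G -> self_adjoint (G - A).
Proof. by move=> Asa Gsa x y; rewrite !sub_lopE Asa Gsa. Qed.

Lemma DFP_self_adjoint G A u :
  self_adjoint A -> self_adjoint G -> self_adjoint (DFP G A u).
Proof.
move=> Asa Gsa x y; rewrite !DFPE.
rewrite (Gsa y x) (Asa y u) (Gsa y u) (Asa u x) (Gsa u x).
move: (G x y : R) (A u u : R) (G u u : R) => *.
move: (A x u : R) (A u y : R) (G x u : R) (G u y : R) => *.
by ring.
Qed.

Lemma SR1_self_adjoint G A u :
  self_adjoint A -> self_adjoint G -> self_adjoint (SR1 G A u).
Proof.
move=> Asa Gsa x y; rewrite (SR1E A G u x y) (SR1E A G u y x) (Gsa y x).
have Dsa := self_adjointB Asa Gsa.
congr (_ - _ * _); rewrite (Dsa y u) (Dsa u x).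
exact: (@mulrC R).
Qed.

Lemma Broyd_self_adjoint tau G A u :
  self_adjoint A -> self_adjoint G -> self_adjoint (Broyd tau G A u).
Proof.
move=> Asa Gsa; have [GA|GA] := eqVneq (G u) (A u).
  by rewrite /Broyd GA eqxx.
move=> x y; rewrite BroydE // !add_lopE !scale_lopE.
by rewrite (DFP_self_adjoint u Asa Gsa) (SR1_self_adjoint u Asa Gsa).
Qed.

(** For a semidefinite form the denominator of SR1 vanishes only when
    [D u = 0], because Cauchy-Schwarz bounds [(D u y)^2] by [D u u * D y y]. *)
Lemma psd_gt0 D u : self_adjoint D -> psd D -> D u != 0 -> (0 : R) < D u u.
Proof.
move=> Dsa D0 Du; rewrite lt0r D0 andbT; apply: contra Du => /eqP Duu.
apply/eqP/lfunP => y; rewrite zero_lfunE; apply/eqP.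
rewrite -sqrf_eq0 eq_le sqr_ge0 andbT.
by have := cauchy_schwarz u y Dsa D0; rewrite Duu mul0r.
Qed.

(** The vector [y] is the component of [x] that is [A]-orthogonal to [u]: the
    DFP update keeps [G] there, makes [u] orthogonal to it, and copies [A] on
    the line of [u]. *)
Lemma DFP_square G A u x : self_adjoint G -> self_adjoint A -> A u u != 0 ->
  let y := x - (A x u / A u u) *: u in
  DFP G A u x x = G y y + (A x u : R) ^+ 2 / A u u :> R.
Proof.
move=> Gsa Asa Auu /=; rewrite DFPE !lop_bilinE (Gsa u x) (Asa u x).
move: (G x x : R) (A u u : R) (G u u : R) (A x u : R) (G x u : R) Auu => *.
by field.
Qed.

(** Together with [DFP_square] for [G = A], this splits the form of [A] in the
    same way as that of the update. *)
Lemma DFP_same A u : A u u != 0 -> DFP A A u = A.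
Proof.
move=> Auu; apply/lfunP => x; apply/lfunP => y; rewrite DFPE.
move: (A x y : R) (A u u : R) (A x u : R) (A u y : R) Auu => *.
by field.
Qed.

Lemma DFP_bounds eta A G u : self_adjoint A -> self_adjoint G -> 1 <= eta ->
  (0 : R) < A u u -> A ⪯ G -> G ⪯ eta *: A ->
  A ⪯ DFP G A u /\ DFP G A u ⪯ eta *: A.
Proof.
move=> Asa Gsa eta1 Auu /lop_leP AG /lop_leP GA.
have Auu0 : (A u u : R) != 0 by rewrite gt_eqF.
have split_A x := DFP_square u x Asa Asa Auu0.
rewrite (DFP_same A u Auu0) in split_A.
split; apply/lop_leP => x; rewrite (DFP_square u x Gsa Asa Auu0) /=.
  by rewrite (split_A x) /= lerD2r AG.
rewrite scale_lopE (split_A x) /=; set y := x - _.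
have c0 : 0 <= (A x u : R) ^+ 2 / A u u by rewrite divr_ge0 ?sqr_ge0 ?ltW.
have /= := GA y; rewrite scale_lopE.
by move: (A y y : R) (G y y : R) (_ / _ : R) c0 => a g c c0 h; nra.
Qed.

Lemma SR1_bounds A G u : self_adjoint A -> self_adjoint G ->
  A ⪯ G -> G u != A u -> A ⪯ SR1 G A u /\ SR1 G A u ⪯ G.
Proof.
move=> Asa Gsa AG GAu; have Dsa := self_adjointB Asa Gsa.
have Duu : (0 : R) < (G - A) u u.
  by apply: psd_gt0 => //; rewrite add_lfunE opp_lfunE subr_eq0.
split; apply/lop_leP => x; rewrite SR1E (Dsa u x).
  rewrite lerBrDl addrC -lerBrDl -sub_lopE.
  by rewrite mulrC ler_pdivrMr // -expr2 cauchy_schwarz.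
by rewrite gerBl mulr_ge0 ?invr_ge0 ?(ltW Duu) // -expr2 sqr_ge0.
Qed.

Lemma lop_le_trans A G D : A ⪯ G -> G ⪯ D -> A ⪯ D.
Proof.
move=> /lop_leP AG /lop_leP GD; apply/lop_leP => x.
exact: le_trans (AG x) (GD x).
Qed.

Lemma lop_le_convex tau A1 A2 A G : 0 <= tau <= 1 -> A ⪯ A1 /\ A1 ⪯ G ->
  A ⪯ A2 /\ A2 ⪯ G ->
  A ⪯ tau *: A1 + (1 - tau) *: A2 /\ tau *: A1 + (1 - tau) *: A2 ⪯ G.
Proof.
move=> /andP[t0 t1] [/lop_leP A1l /lop_leP A1u] [/lop_leP A2l /lop_leP A2u].
split; apply/lop_leP => x; rewrite !add_lopE !scale_lopE;
  move: (A1l x) (A1u x) (A2l x) (A2u x);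
  move: (A x x : R) (A1 x x : R) (A2 x x : R) (G x x : R) => *; nra.
Qed.

(** The condition [1 <= eta] of [DFP_bounds] holds because a nontrivial update
    has [u != 0], where [A u u <= eta * A u u] with [A u u > 0]. *)
Lemma Broyd_bounds eta tau A G u : positive_definite A ->
  self_adjoint A -> self_adjoint G -> 0 <= tau <= 1 ->
  A ⪯ G -> G ⪯ eta *: A ->
  A ⪯ Broyd tau G A u /\ Broyd tau G A u ⪯ eta *: A.
Proof.
move=> Apd Asa Gsa tau01 AG GA; have [GAu|GAu] := eqVneq (G u) (A u).
  by rewrite /Broyd GAu eqxx.
have u0 : u != 0 by apply: contraNneq GAu => ->; rewrite !linear0.
have Auu : (0 : R) < A u u by apply: Apd.
have eta1 : 1 <= eta.
  have /lop_leP/(_ u) := lop_le_trans AG GA.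
  by rewrite scale_lopE ler_pMl.
rewrite BroydE //; apply: lop_le_convex => //; first exact: DFP_bounds.
have [Al Au] := SR1_bounds u Asa Gsa AG GAu; split=> //.
exact: lop_le_trans GA.
Qed.

End Updates.

(** * Inverses of the operators *)

Lemma injective_lfunVK (K : fieldType) (aT rT : vectType K) (f : 'Hom(aT, rT)) :
  (dim rT <= dim aT)%N -> (forall v, f v = 0 -> v = 0) -> cancel f^-1%VF f.
Proof.
move=> dimf injf w; apply: limg_lfunVK.
have kerf : lker f = 0%VS.
  apply/eqP; rewrite -subv0; apply/subvP => v.
  by rewrite memv_ker memv0 => /eqP/injf ->.
suff -> : limg f = fullv by exact: memvf.
apply/eqP; rewrite eqEdim subvf /=.
by have := limg_ker_dim f fullv; rewrite kerf capv0 dimv0 add0n !dimvf => ->.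
Qed.

Section Inverses.
Set Implicit Arguments.
Context {R : realType} {E : vectType R}.
Implicit Types (A G D : 'Hom(E, dual R E)) (u x y z : E) (eta tau : R).

Lemma dim_dual : dim (dual R E : vectType R) = dim E.
Proof. by rewrite -[RHS]muln1. Qed.

Lemma pd_inj A : positive_definite A -> forall x, A x = 0 -> x = 0.
Proof.
move=> Apd x Ax; apply/eqP; apply: contraT => /Apd.
by rewrite Ax zero_lfunE ltxx.
Qed.

Lemma pd_lfunVK A : positive_definite A -> cancel A^-1%VF A.
Proof.
by move=> Apd; apply: injective_lfunVK; [rewrite dim_dual | exact: pd_inj].
Qed.

Lemma pd_lfunK A : positive_definite A -> cancel A A^-1%VF.
Proof.
move=> Apd x; apply/eqP; rewrite -subr_eq0; apply/eqP/(pd_inj Apd).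
by rewrite linearB /= pd_lfunVK ?subrr.
Qed.

Lemma pd_le A G : positive_definite A -> A ⪯ G -> positive_definite G.
Proof. by move=> Apd /lop_leP AG x /Apd/lt_le_trans; apply; exact: AG. Qed.

(** The operator [P = \sum_i e_i e_i^*] is symmetric, and it is injective since
    [P s = \sum_i s(e_i) e_i] vanishes only if every [s(e_i)] does; so its
    inverse is symmetric as well. *)
Lemma Bop_self_adjoint n (e : n.-tuple E) :
  basis_of fullv e -> self_adjoint (Bop e).
Proof.
move=> he x y; rewrite /Bop; set P := \sum_(i < n) rank1 e`_i.
have PE s : P s = \sum_(i < n) (s e`_i : R) *: e`_i.
  by rewrite sum_lfunE; apply: eq_bigr => i _; rewrite rank1E.
have PK : cancel P^-1%VF P.
  apply: injective_lfunVK; first by rewrite dim_dual.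
  move=> s; rewrite PE => Ps0.
  have /freeP/(_ (fun i : 'I_n => s e`_i) Ps0) se0 := basis_free he.
  apply/lfunP => z; rewrite zero_lfunE (coord_basis he (memvf z)) linear_sum.
  by rewrite big1 // => i _; rewrite linearZ /= se0 scaler0.
rewrite -{1}[y]PK -{2}[x]PK !PE !linear_sum; apply: eq_bigr => i _.
by rewrite !linearZ; exact: (@mulrC R).
Qed.

(** * Contraction of the error *)

(** With [q = G^-1 A x], so that [G q = A x], the upper bound on [A G^-1 A] comes
    from [A (x - q) (x - q) >= 0] together with [A ⪯ G], and the lower bound from
    [G (q - x / eta) (q - x / eta) >= 0] together with [G ⪯ eta A]. *)
Lemma residual_bounds eta A G x : self_adjoint A -> self_adjoint G ->
  positive_definite A -> 0 < eta -> A ⪯ G -> G ⪯ eta *: A ->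
  let r := A x (x - G^-1%VF (A x)) : R in
  0 <= r /\ r <= (1 - eta^-1) * A x x.
Proof.
move=> Asa Gsa Apd eta0 AG GA /=.
have Gpd := pd_le Apd AG.
have psdA z : 0 <= (A z z : R).
  by have [->|/Apd/ltW//] := eqVneq z 0; rewrite linear0.
have psdG z : 0 <= (G z z : R).
  by have [->|/Gpd/ltW//] := eqVneq z 0; rewrite linear0.
set q := G^-1%VF (A x); have Gq : G q = A x by exact: pd_lfunVK.
have Gqx : G q x = A x x :> R by rewrite Gq.
have Gqq : G q q = A x q :> R by rewrite Gq.
move/lop_leP/(_ q): AG; move/lop_leP/(_ x): GA; rewrite scale_lopE.
have := psdA (x - q); have := psdG (q - eta^-1 *: x).
rewrite !lop_bilinE (Asa q x) (Gsa x q) Gqx Gqq.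
move: (A x x : R) (A x q : R) (A q q : R) (G x x : R) => a b c d h1 h2 h3 h4.
split; first lra.
have h5 : eta^-1 * eta^-1 * d <= eta^-1 * a.
  rewrite -mulrA ler_pM2l ?invr_gt0 //.
  by rewrite mulrC ler_pdivrMr // mulrC.
by nra.
Qed.

(** Cauchy-Schwarz for [D = A - A G^-1 A] at [x] and [w = x - G^-1 A x], where
    [D x = A w]. *)
Lemma newton_contraction eta A G x : self_adjoint A -> self_adjoint G ->
  positive_definite A -> 0 < eta -> A ⪯ G -> G ⪯ eta *: A ->
  A (x - G^-1%VF (A x)) (x - G^-1%VF (A x))
    <= (1 - eta^-1) ^+ 2 * A x x :> R.
Proof.
move=> Asa Gsa Apd eta0 AG GA; set w := x - _.
pose D : 'Hom(E, dual R E) := A - (A \o G^-1 \o A)%VF.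
have DE z y : D z y = A (z - G^-1%VF (A z)) y :> R.
  by rewrite sub_lopE !comp_lfunE linearB add_lfunE opp_lfunE.
have Dbounds z : 0 <= (D z z : R) /\ D z z <= (1 - eta^-1) * A z z :> R.
  by rewrite DE Asa; exact: residual_bounds.
have Dsa : self_adjoint D.
  have GK := pd_lfunVK (pd_le Apd AG).
  move=> z y; rewrite !DE linearB [in RHS]linearB.
  rewrite !add_lfunE !opp_lfunE (Asa z y).
  congr (_ - _); rewrite Asa (Asa _ z).
  by rewrite -{1}(GK (A y)) -{2}(GK (A z)) Gsa.
have cs := cauchy_schwarz x w Dsa (fun z => proj1 (Dbounds z)).
rewrite DE -/w in cs.
have [x1 x2] := Dbounds x; have [w1 w2] := Dbounds w.
have [w0|/Apd Aw] := eqVneq w 0.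
  rewrite w0 linear0 mulr_ge0 ?sqr_ge0 //.
  by have [->|/Apd/ltW//] := eqVneq x 0; rewrite linear0.
rewrite -(ler_pM2r Aw).
have : (D x x : R) * D w w <= ((1 - eta^-1) * A x x) * ((1 - eta^-1) * A w w).
  by apply: ler_pM.
move: cs; rewrite expr2.
move: (A w w : R) (A x x : R) (D x x : R) (D w w : R) (1 - eta^-1).
move=> a b d f c h1 h2; apply: le_trans h1 _; apply: le_trans h2 _.
by rewrite le_eqVlt; apply/orP; left; apply/eqP; ring.
Qed.

End Inverses.

(** * The convergence rate *)

Theorem theorem3p3 (R : realType) (E : vectType R) (n : nat)
    (e : n.-tuple E) (he : basis_of fullv e)
    (A : 'Hom(E, dual R E)) (b : dual R E) (mu L : R)
    (A_sa : self_adjoint A) (A_pd : positive_definite A)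
    (mu_gt0 : 0 < mu) (L_gt0 : 0 < L)
    (muB_le_A : mu *: Bop e ⪯ A) (A_le_LB : A ⪯ L *: Bop e)
    (x : nat -> E) (G : nat -> 'Hom(E, dual R E))
    (u : nat -> E) (tau : nat -> R)
    (hqn : quasi_newton e (quad A b) A L x G u tau) (k : nat) :
  (A ⪯ G k /\ G k ⪯ (L / mu) *: A) /\
  lambda e (quad A b) A (x k)
    <= (1 - mu / L) ^+ k * lambda e (quad A b) A (x 0%N).
Proof.
case: hqn => G0 xS tau01 GS.
have eta_gt0 : 0 < L / mu by rewrite divr_gt0.
have G_bounds j : self_adjoint (G j) /\ A ⪯ G j /\ G j ⪯ (L / mu) *: A.
  elim: j => [|j [Gsa [AG GA]]].
    rewrite G0; split; [|split; [exact: A_le_LB|]].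
      by move=> y z; rewrite !scale_lopE (Bop_self_adjoint e he).
    apply/lop_leP => y; move/lop_leP/(_ y): muB_le_A.
    by rewrite !scale_lopE mulrAC ler_pdivlMr // -mulrA ler_pM2l // mulrC.
  rewrite GS; split; first exact: Broyd_self_adjoint.
  exact: Broyd_bounds.
split; first by have [] := G_bounds k.
pose xopt : E := A^-1%VF b.
pose r j := x j - xopt.
have gradE j : grad e (quad A b) (x j) = A (r j).
  by rewrite grad_quad // linearB /= pd_lfunVK.
have lambdaE j : lambda e (quad A b) A (x j) = Num.sqrt (A (r j) (r j)).
  by rewrite /lambda gradE pd_lfunK.
have rS j : r j.+1 = r j - (G j)^-1%VF (A (r j)).
  by rewrite {1}/r xS gradE addrAC.
have muLE : mu / L = (L / mu)^-1 by rewrite invf_div.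
have [c0|c0] := leP 0 (1 - mu / L); last first.
  (* A nonzero error would contradict the two bounds on the residual form, so
     this case is that of the zero space. *)
  have r0 j : r j = 0.
    apply/eqP; apply: contraT => /A_pd Ar.
    have [Gsa [AG GA]] := G_bounds j.
    have [h1 h2] := residual_bounds _ (r j) A_sa Gsa A_pd eta_gt0 AG GA.
    by have := le_trans h1 h2; rewrite -muLE pmulr_lge0 // leNgt c0.
  by rewrite !lambdaE !r0 linear0 sqrtr0 mulr0.
elim: k => [|k IH]; first by rewrite mul1r.
rewrite exprS -mulrA; apply: le_trans (ler_wpM2l c0 IH).
rewrite !lambdaE rS -[X in X * _](ger0_norm c0) -sqrtr_sqr -sqrtrM ?sqr_ge0 //.
apply: ler_wsqrtr; rewrite muLE.
have [Gsa [AG GA]] := G_bounds k.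
exact: newton_contraction.
Qed.
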